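(* Consider the time-varying system $x_k=M_kx_{k-1}+w_k$, $y_k=H_kx_k+v_k$ under the standing assumptions in the context, with forecast error covariances $P_k=X_kX_k^{T}$ solving the Riccati recursion there. Assume the system is uniformly completely controllable and that the sequence $P_k$ is uniformly bounded, i.e. there is $0<p_{\sup}<\infty$ with $P_k\le p_{\sup}I_n$ for all $k$. Then it is necessary that $$\frac{e^{2\lambda_1}}{1+\sup_k\sigma_1^2\left(R_k^{-\frac12}H_kX_k\right)}<1,$$ where $\sigma_1$ denotes the largest singular value and $\lambda_1$ is the largest Lyapunov exponent (the quotient being read as $0$ if the supremum is $+\infty$).
   Context: System. $M_k\in\mathbb R^{n\times n}$ are invertible ($k\in\mathbb Z$), $H_k\in\mathbb R^{d\times n}$ with $d\le n$; $w_k,v_k$ are mutually independent mean-zero Gaussian white sequences with covariances $Q_k\in\mathbb R^{n\times n}$ and $R_k\in\mathbb R^{d\times d}$, and there are real constants such that for all $k$: $0\le q_{\inf}I_n\le Q_k\le q_{\sup}I_n$, $0<r_{\inf}I_d\le R_k\le r_{\sup}I_d$ ($B\le A$ means $A-B$ is positive semi-definite). For $k\ge l$, $M_{k:l}=M_kM_{k-1}\cdots M_{l+1}$ is the propagator from time $l$ to time $k$, $M_{k:k}=I_n$, and $M_{l:k}=M_{k:l}^{-1}$. $\Omega_k=H_k^{T}R_k^{-1}H_k$. Riccati recursion. Starting from a prior covariance $P_0\ge 0$, $P_{k+1}=M_{k+1}(I_n+P_k\Omega_k)^{-1}P_kM_{k+1}^{T}+Q_{k+1}$; equivalently $P_{k+1}=M_{k+1}X_k(I_n+X_k^{T}\Omega_kX_k)^{-1}X_k^{T}M_{k+1}^{T}+Q_{k+1}$,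 where $X_k\in\mathbb R^{n\times n}$ is a root, $P_k=X_kX_k^{T}$. Controllability. $\Upsilon_{k:j}=\sum_{l=j}^kM_{k:l}Q_lM_{k:l}^{T}$. The system is uniformly completely controllable if there are $N_\Upsilon,a,b>0$ independent of $k$ with $0<aI_n\le\Upsilon_{k:k-N_\Upsilon}\le bI_n$ for all $k>N_\Upsilon$. Lyapunov structure (standing assumption: Lyapunov–Perron regularity of $x_k=M_kx_{k-1}$). There are real numbers $\lambda_1>\dots>\lambda_p$ (Lyapunov exponents) and subspaces $\mathcal E_k^i\subset\mathbb R^n$ with $\dim\mathcal E^i_k=\kappa_i$, such that for all $k,l\in\mathbb Z$, $\bigoplus_{i=1}^p\mathcal E^i_k=\mathbb R^n$, $M_{k\pm l:k}\mathcal E^i_k=\mathcal E^i_{k\pm l}$, and for nonzero $v\in\mathcal E^i_k$, $\lim_{l\to\infty}\frac1l\log\|M_{k\pm l:k}v\|=\pm\lambda_i$. The far-past operator $W^-(k)=\lim_{l\to\infty}[M_{k:k-l}^{-T}M_{k:k-l}^{-1}]^{1/(2l)}$ is a well-defined symmetric positive definite matrix with distinct eigenvalues $e^{-\lambda_i}$ of multiplicity $\kappa_i$. The backward Lyapunov vectors $B_k^{i_j}$ ($1\le i\le p$, $1\le j\le\kappa_i$) form an orthonormal eigenbasis of $W^-(k)$ with $W^-(k)B_k^{i_j}=e^{-\lambda_i}B_k^{i_j}$; writing $B_k$ for the orthogonal matrix with these columns ordered block-wise by $i$, they are chosen so that $M_kB_{k-1}=B_kT_k$ with $T_k$ upper triangular.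 Uniform convergence (standing assumption). For each $\epsilon>0$ and each $i$ there is $N_{i,\epsilon}$, independent of $k$ and $j$, such that for every $B_k^{i_j}$, whenever $k-l>N_{i,\epsilon}$, $-\epsilon<\frac1{k-l}\log\|M_{k:l}^{T}B_k^{i_j}\|-\lambda_i<\epsilon$. *)

(* Defs.v *)
From HB Require Import structures.
From mathcomp Require Import all_boot all_order all_algebra.
From mathcomp Require Import finmap.
From mathcomp Require Import all_classical all_reals all_analysis.
From mathcomp Require Import spectral.

Set Implicit Arguments.
Unset Strict Implicit.
Unset Printing Implicit Defensive.

Import Order.TTheory GRing.Theory Num.Theory.
Import numFieldNormedType.Exports.

Local Open Scope classical_set_scope.
Local Open Scope ring_scope.

Section Matrices.
Context {R : realType}.

Definition psd n (A : 'M[R]_n) : Prop :=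
  A \is symmetricmx /\ forall v : 'cV[R]_n, 0 <= (v^T *m A *m v) 0 0.

Definition pos_def n (A : 'M[R]_n) : Prop :=
  A \is symmetricmx /\
  forall v : 'cV[R]_n, v != 0 -> 0 < (v^T *m A *m v) 0 0.

Definition loewner_le n (B A : 'M[R]_n) : Prop := psd (A - B).

Definition norm2 n (v : 'cV[R]_n) : R := Num.sqrt ((v^T *m v) 0 0).

(* A^{1/m}: the unique positive semi-definite m-th root when A is positive
   semi-definite and 0 < m; an arbitrary matrix otherwise. *)
Definition psd_root m n (A : 'M[R]_n) : 'M[R]_n :=
  xget 0 [set S : 'M[R]_n | psd S /\ S ^+ m = A].

Definition singular_value m n (A : 'M[R]_(m, n)) : set R :=
  [set s | 0 <= s /\ eigenvalue (A^T *m A) (s ^+ 2)].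

(* The supremum is a maximum as soon as 0 < n: singular_value A is then finite
   and nonempty. *)
Definition sigma1 m n (A : 'M[R]_(m, n)) : R := sup (singular_value A).

End Matrices.

Section Propagator.
Context {R : realType} {n : nat} (M : int -> 'M[R]_n).

(* fwd_propagator l m is M_{l+m:l} = M_{l+m} *m ... *m M_{l+1}. *)
Fixpoint fwd_propagator (l : int) (m : nat) : 'M[R]_n :=
  if m is m'.+1 then M (l + m'.+1%:Z) *m fwd_propagator l m' else 1%:M.

Definition propagator (k l : int) : 'M[R]_n :=
  if l <= k then fwd_propagator l `|k - l|%N
  else invmx (fwd_propagator k `|l - k|%N).

(* controllability Q k m is Upsilon_{k:k-m}, summed over l = k - i. *)
Definition controllability (Q : int -> 'M[R]_n) (k : int) (m : nat) :
    'M[R]_n :=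
  \sum_(i < m.+1) propagator k (k - i%:Z) *m Q (k - i%:Z)
                  *m (propagator k (k - i%:Z))^T.

Definition uniformly_completely_controllable (Q : int -> 'M[R]_n) : Prop :=
  exists (N : nat) (a b : R), [/\ (0 < N)%N, 0 < a, 0 < b &
    forall k : int, N%:Z < k ->
      loewner_le a%:M (controllability Q k N) /\
      loewner_le (controllability Q k N) b%:M].

End Propagator.

Section Noise.
Context {disp : measure_display} {T : measurableType disp} {R : realType}.
Variable Pr : probability T R.

Definition random_vector m (X : T -> 'cV[R]_m) : Prop :=
  forall i, measurable_fun setT (fun t => X t i 0).

(* normal_prob m s is not the point mass at m when s = 0, hence the case
   distinction: singular covariances are allowed. *)
Definition gaussian_variable (X : T -> R) : Prop :=
  exists m s : R, 0 <= s /\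
    forall A : set R, measurable A ->
      Pr (X @^-1` A) = if s == 0 then \d_m A else normal_prob m s A.

Definition centered_gaussian_vector m (X : T -> 'cV[R]_m) (C : 'M[R]_m) :
    Prop :=
  [/\ random_vector X,
      forall u : 'cV[R]_m, gaussian_variable (fun t => (u^T *m X t) 0 0),
      forall i, expectation Pr (fun t => X t i 0) = 0%E &
      forall i j,
        covariance Pr (fun t => X t i 0) (fun t => X t j 0) = (C i j)%:E].

Definition vector_sigma_algebra m (X : T -> 'cV[R]_m) : set (set T) :=
  <<s [set A | exists i (B : set R),
        measurable B /\ A = (fun t => X t i 0) @^-1` B] >>.

Definition mutually_independent (I : choiceType) (F : I -> set (set T)) :
    Prop :=
  forall (J : {fset I}) (E : I -> set T),
    (forall i, i \in J -> F i (E i)) ->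
    Pr (\bigcap_(i in [set` J]) E i) = (\prod_(i <- J) Pr (E i))%E.

(* Mutual independence of all the vectors w_k and v_l together expresses both
   the whiteness of each sequence and the independence of the two. *)
Definition gaussian_white_noises n d
    (w : int -> T -> 'cV[R]_n) (v : int -> T -> 'cV[R]_d)
    (Qc : int -> 'M[R]_n) (Rc : int -> 'M[R]_d) : Prop :=
  [/\ forall k, centered_gaussian_vector (w k) (Qc k),
      forall k, centered_gaussian_vector (v k) (Rc k) &
      mutually_independent (fun s : (int + int)%type =>
        match s with
        | inl k => vector_sigma_algebra (w k)
        | inr k => vector_sigma_algebra (v k)
        end)].

Definition state_space_model n d
    (M : int -> 'M[R]_n) (H : int -> 'M[R]_(d, n))
    (x : int -> T -> 'cV[R]_n) (y : int -> T -> 'cV[R]_d)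
    (w : int -> T -> 'cV[R]_n) (v : int -> T -> 'cV[R]_d) : Prop :=
  [/\ forall k, random_vector (x k),
      forall k t, x k t = M k *m x (k - 1) t + w k t &
      forall k t, y k t = H k *m x k t + v k t].

End Noise.

Section Filter.
Context {R : realType} {n d : nat}.

Definition bounded_covariances (Qc : int -> 'M[R]_n) (Rc : int -> 'M[R]_d) :
    Prop :=
  exists q_inf q_sup r_inf r_sup : R,
    [/\ 0 <= q_inf, 0 < r_inf,
        forall k, loewner_le q_inf%:M (Qc k) /\ loewner_le (Qc k) q_sup%:M &
        forall k, loewner_le r_inf%:M (Rc k) /\ loewner_le (Rc k) r_sup%:M].

Definition precision (H : int -> 'M[R]_(d, n)) (Rc : int -> 'M[R]_d)
    (k : int) : 'M[R]_n :=
  (H k)^T *m invmx (Rc k) *m H k.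

Definition riccati (M : int -> 'M[R]_n) (H : int -> 'M[R]_(d, n))
    (Qc : int -> 'M[R]_n) (Rc : int -> 'M[R]_d) (P : nat -> 'M[R]_n) : Prop :=
  psd (P 0%N) /\
  forall k : nat,
    P k.+1 = M k.+1%:Z
               *m (invmx (1%:M + P k *m precision H Rc k%:Z) *m P k)
               *m (M k.+1%:Z)^T
             + Qc k.+1%:Z.

End Filter.

Section Lyapunov.
Context {R : realType} {n p : nat}.
Variables (M : int -> 'M[R]_n) (lam : 'I_p.+1 -> R) (kap : 'I_p.+1 -> nat).

Definition lyapunov_perron_regular
    (E : int -> 'I_p.+1 -> {vspace 'cV[R]_n}) : Prop :=
  [/\ forall i j : 'I_p.+1, (i < j)%N -> lam j < lam i,
      forall k i, (0 < kap i)%N /\ \dim (E k i) = kap i,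
      forall k, directv (\sum_i E k i)%VS /\ (\sum_i E k i)%VS = fullv,
      forall (k l : int) i,
        (linfun (mulmx (propagator M (k + l) k)) @: E k i)%VS = E (k + l) i &
      forall (k : int) i (v : 'cV[R]_n), v \in E k i -> v != 0 ->
        ((fun l : nat =>
            l%:R^-1 * ln (norm2 (propagator M (k + l%:Z) k *m v)))
           @ \oo --> lam i) /\
        ((fun l : nat =>
            l%:R^-1 * ln (norm2 (propagator M (k - l%:Z) k *m v)))
           @ \oo --> - lam i)].

Definition far_past_operator (W : int -> 'M[R]_n) : Prop :=
  forall k : int,
    [/\ (fun l : nat =>
           psd_root (2 * l) ((invmx (propagator M k (k - l%:Z)))^T
                               *m invmx (propagator M k (k - l%:Z))))
          @ \oo --> W k,
        pos_def (W k) &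
        char_poly (W k) =
          \prod_i ('X - (expR (- lam i))%:P) ^+ kap i].

(* B k i is the block of columns B_k^{i_1}, ..., B_k^{i_(kap i)}; the matrix B_k
   is their concatenation, with sum_i kap i = n columns. *)
Definition backward_lyapunov_vectors (W : int -> 'M[R]_n)
    (B : int -> forall i : 'I_p.+1, 'M[R]_(n, kap i)) : Prop :=
  [/\ forall k, (\mxrow_i B k i)^T *m (\mxrow_i B k i) = 1%:M,
      forall k, (\mxrow_i B k i) *m (\mxrow_i B k i)^T = 1%:M,
      forall k i (j : 'I_(kap i)),
        W k *m col j (B k i) = expR (- lam i) *: col j (B k i) &
      forall k, exists T : 'M[R]_(\sum_i kap i),
        (forall r c : 'I_(\sum_i kap i), (c < r)%N -> T r c = 0) /\
        M k *m (\mxrow_i B (k - 1) i) = (\mxrow_i B k i) *m T].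

Definition uniform_convergence
    (B : int -> forall i : 'I_p.+1, 'M[R]_(n, kap i)) : Prop :=
  forall (eps : R) i, 0 < eps ->
    exists N : nat, forall (k l : int) (j : 'I_(kap i)), N%:Z < k - l ->
      - eps < (k - l)%:~R^-1 * ln (norm2 ((propagator M k l)^T *m col j (B k i)))
              - lam i < eps.

End Lyapunov.

(* Main.v *)
Require Import Defs.
From HB Require Import structures.
From mathcomp Require Import all_boot all_order all_algebra.
From mathcomp Require Import finmap.
From mathcomp Require Import all_classical all_reals all_analysis.
From mathcomp Require Import spectral.
From mathcomp Require Import ring lra.

Set Implicit Arguments.
Unset Strict Implicit.
Unset Printing Implicit Defensive.

Import Order.TTheory GRing.Theory Num.Theory.
Import numFieldNormedType.Exports.

Local Open Scope classical_set_scope.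
Local Open Scope ring_scope.

(** Write [alpha] for the supremum of [sigma_1^2(R_k^(-1/2) H_k X_k)]; if it is
    infinite the quotient is [0], so let it be finite and put
    [beta = 1 / (1 + alpha)]. Covariances are compared through their quadratic
    forms [v |-> v^T P v].

    One assimilation step cannot shrink the covariance by more than [beta]. The
    updated covariance is [X (I + G)^-1 X^T] with [G = X^T Omega X], and [G] is
    the Gram matrix of [R^(-1/2) H X], so that [I + G <= (1 + alpha) I] and
    [P_{k+1} >= beta M P_k M^T + Q] ([update_lower_bound], [precision_bound]).
    That [sigma_1^2] bounds the form [G], and that [R^(-1/2)] exists, rest on
    the largest eigenvalue of a positive semi-definite matrix
    ([psd_top_eigenvector], [psd_sqrt_exists]).

    Iterating over a window of [N + 1] steps, controllability makes the noise
    contribute a term of at least [c I], [c > 0], to the covariance at the end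
    of the window:
    [P_{k+N+1} >= beta^(N+1) M_{k+N+1:k} P_k M_{k+N+1:k}^T + c I]
    ([covariance_window]). This alone would only show that
    [beta e^(2 lambda_1) <= 1], since the exponents control the growth up to
    subexponential factors. The strict inequality comes from the upper bound on
    [P]: [c I >= (c / p_sup) P_{k+N+1}] can be moved to the left-hand side, and
    leaves [rho P_{k+N+1} >= beta^(N+1) M_{k+N+1:k} P_k M_{k+N+1:k}^T] with
    [rho < 1] ([covariance_contraction]). Hence
    [beta^m |M_{k:k-m}^T v|^2] decays exponentially in [m], uniformly over unit
    vectors [v] ([propagated_decay]).

    For [v] a first backward Lyapunov vector at time [k], uniform convergence
    gives [|M_{k:k-m}^T v|^2 >= e^(2 (lambda_1 - eps) m)] ([backward_growth]).
    If [beta e^(2 lambda_1) >= 1], a small [eps] contradicts the decay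
    ([growth_beats_decay]). *)

(** * Quadratic forms *)

Section Dotp.
Context {R : realType}.

Definition dotp n (u v : 'cV[R]_n) : R := (u^T *m v) 0 0.

Lemma dotpE n (u v : 'cV[R]_n) : dotp u v = \sum_i u i 0 * v i 0.
Proof. by rewrite /dotp mxE; apply: eq_bigr => i _; rewrite mxE. Qed.

Lemma dotpC n (u v : 'cV[R]_n) : dotp u v = dotp v u.
Proof. by rewrite !dotpE; apply: eq_bigr => i _; rewrite mulrC. Qed.

Lemma dotpDr n (u v w : 'cV[R]_n) : dotp u (v + w) = dotp u v + dotp u w.
Proof. by rewrite /dotp mulmxDr mxE. Qed.

Lemma dotpZr n (u v : 'cV[R]_n) a : dotp u (a *: v) = a * dotp u v.
Proof. by rewrite /dotp -scalemxAr mxE. Qed.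

Lemma dotpBr n (u v w : 'cV[R]_n) : dotp u (v - w) = dotp u v - dotp u w.
Proof. by rewrite dotpDr -scaleN1r dotpZr mulN1r. Qed.

Lemma dotpDl n (u v w : 'cV[R]_n) : dotp (v + w) u = dotp v u + dotp w u.
Proof. by rewrite dotpC dotpDr !(dotpC u). Qed.

Lemma dotpZl n (u v : 'cV[R]_n) a : dotp (a *: v) u = a * dotp v u.
Proof. by rewrite dotpC dotpZr (dotpC u). Qed.

Lemma dotpBl n (u v w : 'cV[R]_n) : dotp (v - w) u = dotp v u - dotp w u.
Proof. by rewrite dotpC dotpBr !(dotpC u). Qed.

Lemma dotp0r n (u : 'cV[R]_n) : dotp u 0 = 0.
Proof. by rewrite /dotp mulmx0 mxE. Qed.

Lemma dotp_mull m n (A : 'M[R]_(m, n)) (u : 'cV[R]_n) (v : 'cV[R]_m) :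
  dotp (A *m u) v = dotp u (A^T *m v).
Proof. by rewrite /dotp trmx_mul mulmxA. Qed.

Lemma dotp_ge0 n (u : 'cV[R]_n) : 0 <= dotp u u.
Proof. by rewrite dotpE sumr_ge0 // => i _; rewrite -expr2 sqr_ge0. Qed.

Lemma dotp_eq0 n (u : 'cV[R]_n) : (dotp u u == 0) = (u == 0).
Proof.
apply/idP/eqP => [|->]; last by rewrite dotp0r.
rewrite dotpE psumr_eq0 => [/allP u0|i _]; last by rewrite -expr2 sqr_ge0.
apply/matrixP => i j; rewrite ord1 mxE; apply/eqP.
by have := u0 i (mem_index_enum _); rewrite mulf_eq0 orbb.
Qed.

Lemma dotp_gt0 n (u : 'cV[R]_n) : u != 0 -> 0 < dotp u u.
Proof. by move=> u0; rewrite lt_def dotp_eq0 u0 dotp_ge0. Qed.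

Lemma norm2E n (u : 'cV[R]_n) : norm2 u ^+ 2 = dotp u u.
Proof. by rewrite sqr_sqrtr // dotp_ge0. Qed.

End Dotp.

Section Psd.
Context {R : realType}.

Lemma psdP n (A : 'M[R]_n) :
  psd A <-> A^T = A /\ forall v, 0 <= dotp v (A *m v).
Proof.
split=> -[sA pA]; split.
- by move: sA => /is_hermitianmxP; rewrite expr0 scale1r map_mx_id.
- by move=> v; rewrite /dotp mulmxA.
- by apply/is_hermitianmxP; rewrite expr0 scale1r map_mx_id.
- by move=> v; rewrite -mulmxA; exact: pA.
Qed.

Lemma loewner_leP n (A B : 'M[R]_n) v :
  loewner_le A B -> dotp v (A *m v) <= dotp v (B *m v).
Proof. by case/psdP => _ /(_ v); rewrite mulmxBl dotpBr subr_ge0. Qed.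

Lemma psd_cong m n (A : 'M[R]_n) (F : 'M[R]_(n, m)) :
  psd A -> psd (F^T *m A *m F).
Proof.
move=> /psdP[sA pA]; apply/psdP; split.
  by rewrite !trmx_mul trmxK sA mulmxA.
by move=> v; rewrite -!mulmxA -dotp_mull pA.
Qed.

Lemma psd_gram m n (F : 'M[R]_(m, n)) : psd (F^T *m F).
Proof.
apply/psdP; split; first by rewrite trmx_mul trmxK.
by move=> v; rewrite -mulmxA -dotp_mull dotp_ge0.
Qed.

Lemma dotp_sym n (A : 'M[R]_n) u v :
  A^T = A -> dotp u (A *m v) = dotp (A *m u) v.
Proof. by move=> sA; rewrite dotp_mull sA. Qed.

(** The discriminant of the nonnegative quadratic polynomial
    [t |-> (x + t y)^T A (x + t y)] is nonpositive. *)
Lemma psd_cauchy_schwarz n (A : 'M[R]_n) x y : psd A ->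
  dotp x (A *m y) ^+ 2 <= dotp x (A *m x) * dotp y (A *m y).
Proof.
move=> /psdP[sA pA].
set b := dotp x (A *m y); set a := dotp x (A *m x); set c := dotp y (A *m y).
have q s t : 0 <= s ^+ 2 * a + 2 * s * t * b + t ^+ 2 * c.
  have := pA (s *: x + t *: y).
  rewrite mulmxDr -!scalemxAr dotpDl !dotpDr !dotpZl !dotpZr.
  rewrite [dotp y (A *m x)]dotp_sym // [dotp (A *m y) x]dotpC -/a -/b -/c.
  by congr (_ <= _); ring.
have [c0|c_gt0] := leP c 0; last first.
  have := q c (- b).
  have -> : c ^+ 2 * a + 2 * c * - b * b + (- b) ^+ 2 * c
          = c * (a * c - b ^+ 2) by ring.
  by rewrite pmulr_rge0 // subr_ge0.
have {c0}c0 : c = 0 by apply/eqP; rewrite eq_le c0 pA.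
rewrite c0 mulr0.
(* c = 0 makes the polynomial affine in t; these values of s, t force b = 0 *)
have a0 : 0 <= a := pA x.
have := q b (- (a + 1)); rewrite c0 mulr0 addr0.
have -> : b ^+ 2 * a + 2 * b * - (a + 1) * b = - ((a + 2) * b ^+ 2) by ring.
by rewrite oppr_ge0 pmulr_rle0 // ltr_wpDl.
Qed.

End Psd.

(** * Largest eigenvalue, largest singular value and square root *)

Section Spectrum.
Context {R : realType}.

Lemma dotp_bounded n (A : 'M[R]_n) :
  exists2 C, 0 < C & forall v, dotp v (A *m v) <= C * dotp v v.
Proof.
exists (1 + \sum_i \sum_j `|A i j|) => [|v].
  by rewrite ltr_pwDl ?ltr01 // sumr_ge0 // => i _; rewrite sumr_ge0.
apply: (@le_trans _ _ ((\sum_i \sum_j `|A i j|) * dotp v v)); last first.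
  by rewrite ler_wpM2r ?dotp_ge0 // lerDr ler01.
have sq_le i : v i 0 ^+ 2 <= dotp v v.
  rewrite dotpE (bigD1 i) //= -expr2 lerDl sumr_ge0 // => j _.
  by rewrite -expr2 sqr_ge0.
rewrite {1}dotpE mulr_suml; apply: ler_sum => i _.
rewrite mxE mulr_sumr mulr_suml; apply: ler_sum => j _.
apply: (le_trans (ler_norm _)); rewrite mulrCA normrM ler_wpM2l //.
have := sq_le i; have := sq_le j.
have := sqr_ge0 (v i 0 - v j 0); have := sqr_ge0 (v i 0 + v j 0).
by rewrite ler_norml; nra.
Qed.

(** Cauchy-Schwarz for the form [A], applied to [v] and [A^-1 v]. *)
Lemma psd_unit_coercive n (A : 'M[R]_n) : psd A -> A \in unitmx ->
  exists2 c, 0 < c & forall v, c * dotp v v <= dotp v (A *m v).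
Proof.
move=> pA uA; have [C C0 hC] := dotp_bounded (invmx A).
exists C^-1 => [|v]; first by rewrite invr_gt0.
have [->|v0] := eqVneq v 0; first by rewrite mulmx0 dotp0r mulr0.
have vv := dotp_gt0 v0.
have := psd_cauchy_schwarz v (invmx A *m v) pA.
rewrite mulKVmx // [dotp (invmx A *m v) v]dotpC => h.
have qv : 0 <= dotp v (A *m v) by case/psdP: pA.
rewrite -ler_pdivlMl ?invr_gt0 // invrK.
rewrite -(ler_pM2r vv) -expr2 (le_trans h) //.
by rewrite -mulrA mulrCA ler_wpM2l.
Qed.

Lemma singular_kernel n (A : 'M[R]_n) : A^T = A -> A \notin unitmx ->
  exists2 u : 'cV[R]_n, u != 0 & A *m u = 0.
Proof.
move=> sA; rewrite -row_free_unit -kermx_eq0 => /rowV0Pn[w /sub_kermxP wA w0].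
exists w^T; first by rewrite trmx_eq0.
by rewrite -[A]sA -trmx_mul wA trmx0.
Qed.

Lemma normalizable n (u : 'cV[R]_n) : u != 0 ->
  exists a, dotp (a *: u) (a *: u) = 1.
Proof.
move=> u0; have uu := dotp_gt0 u0.
exists (Num.sqrt (dotp u u))^-1.
rewrite dotpZl dotpZr mulrA -expr2 exprVn sqr_sqrtr ?ltW //.
by rewrite mulVf // gt_eqF.
Qed.

(** The largest eigenvalue of [A] is the least [t] with [A <= t I]: at that [t]
    the positive semi-definite matrix [t I - A] is singular, for otherwise it
    would dominate some [c I] with [0 < c], and [t - c] would do as well. *)
Lemma psd_top_eigenvector n (A : 'M[R]_n) : (0 < n)%N -> psd A ->
  exists mu u, [/\ forall v, dotp v (A *m v) <= mu * dotp v v,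
                   dotp u u = 1 & A *m u = mu *: u].
Proof.
move=> n0 pA; have [sA qA] := iffLR (psdP A) pA.
pose S := [set t | forall v, dotp v (A *m v) <= t * dotp v v].
have [e e0] : exists e : 'cV[R]_n, e != 0.
  exists (const_mx 1); apply/eqP => /matrixP/(_ (Ordinal n0) 0).
  by rewrite !mxE => /eqP; rewrite oner_eq0.
have S0 : S !=set0 by have [C _ hC] := dotp_bounded A; exists C.
have lS v t : v != 0 -> S t -> dotp v (A *m v) / dotp v v <= t.
  by move=> v0 /(_ v) h; rewrite ler_pdivrMr ?dotp_gt0.
have S_lb : has_lbound S.
  by exists (dotp e (A *m e) / dotp e e) => t; exact: lS.
have mu_in : S (inf S).
  move=> v; have [->|v0] := eqVneq v 0; first by rewrite mulmx0 dotp0r mulr0.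
  rewrite -ler_pdivrMr ?dotp_gt0 //; apply: lb_le_inf => // t; exact: lS.
pose N := (inf S)%:M - A.
have qN v : dotp v (N *m v) = inf S * dotp v v - dotp v (A *m v).
  by rewrite mulmxBl mul_scalar_mx dotpBr dotpZr.
have sN : N^T = N by rewrite linearB /= tr_scalar_mx sA.
have pN : psd N by apply/psdP; split=> // v; rewrite qN subr_ge0.
have [uN|nuN] := boolP (N \in unitmx).
  have [c c0 hc] := psd_unit_coercive pN uN.
  have : S (inf S - c).
    by move=> v; have := hc v; rewrite qN mulrBl lerBrDr addrC -lerBrDr.
  by move=> /(ge_inf S_lb); rewrite lerBrDr gerDl leNgt c0.
have [u u0 Nu] := singular_kernel sN nuN; have [a au] := normalizable u0.
exists (inf S), (a *: u); split => //.
move/eqP: Nu; rewrite mulmxBl mul_scalar_mx subr_eq0 => /eqP Nu.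
by rewrite -scalemxAr -Nu !scalerA mulrC.
Qed.

(** [sigma1 A ^+ 2] is at least the largest eigenvalue of [A^T A]; that value
    also bounds the set of singular values, so that its [sup] is meaningful. *)
Lemma sigma1_bound m n (A : 'M[R]_(m, n)) v :
  dotp (A *m v) (A *m v) <= sigma1 A ^+ 2 * dotp v v.
Proof.
have [n0|] := posnP n.
  by have -> : v = 0; [subst n; exact: flatmx0 | rewrite mulmx0 !dotp0r mulr0].
move=> n_gt0; have pG := psd_gram A; have [sG qG] := iffLR (psdP _) pG.
have [mu [u [hmu uu Gu]]] := psd_top_eigenvector n_gt0 pG.
have mu0 : 0 <= mu by have := qG u; rewrite Gu dotpZr uu mulr1.
have u0 : u != 0 by rewrite -dotp_eq0 uu oner_eq0.
rewrite dotp_mull mulmxA (le_trans (hmu v)) // ler_wpM2r ?dotp_ge0 //.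
have mu_in : singular_value A (Num.sqrt mu).
  split; first exact: sqrtr_ge0.
  rewrite sqr_sqrtr //; apply/eigenvalueP; exists u^T; last by rewrite trmx_eq0.
  by apply: trmx_inj; rewrite trmx_mul sG trmxK Gu linearZ /= trmxK.
have ub : has_ubound (singular_value A).
  exists (Num.sqrt mu) => s [s0 /eigenvalueP[w wG w0]].
  rewrite -(ler_sqr s0) ?nnegrE ?sqrtr_ge0 // sqr_sqrtr //.
  have wt0 : w^T != 0 by rewrite trmx_eq0.
  rewrite -(ler_pM2r (dotp_gt0 wt0)) -dotpZr (le_trans _ (hmu w^T)) //.
  by rewrite -linearZ /= -wG trmx_mul sG.
have h := ub_le_sup ub mu_in.
rewrite -(sqr_sqrtr mu0) ler_sqr ?nnegrE ?sqrtr_ge0 //.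
exact: le_trans (sqrtr_ge0 _) h.
Qed.

(** Deflation: with a unit eigenvector [u] for the largest eigenvalue [mu], a
    root [S] of [A - mu u u^T], which has smaller rank, kills [u], so that
    [S + sqrt mu u u^T] is a root of [A]. *)
Lemma psd_sqrt_exists n (A : 'M[R]_n) : psd A ->
  exists S, psd S /\ S *m S = A.
Proof.
move: (leqnn (\rank A)); move: {2}(\rank A) => r.
elim: r A => [|r IHr] A.
  rewrite leqn0 mxrank_eq0 => /eqP -> _.
  exists 0; split; last by rewrite mulmx0.
  by apply/psdP; split=> [|v]; rewrite ?trmx0 // mul0mx dotp0r.
have [->|A0] := eqVneq A 0.
  by move=> _; apply: IHr; rewrite mxrank0.
move=> rA pA; have [sA qA] := iffLR (psdP _) pA.
have n0 : (0 < n)%N.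
  rewrite lt0n; apply: contraNneq A0 => n0; apply/eqP; subst n.
  exact: flatmx0.
have [mu [u [hmu uu Au]]] := psd_top_eigenvector n0 pA.
have mu0 : 0 <= mu by have := qA u; rewrite Au dotpZr uu mulr1.
have uTu : u^T *m u = 1%:M.
  by apply/matrixP => i j; rewrite !ord1 [RHS]mxE eqxx -uu.
pose U := u *m u^T.
have Uv v : U *m v = dotp u v *: u.
  by rewrite -mulmxA [u^T *m v]mx11_scalar mul_mx_scalar.
have UU : U *m U = U by rewrite -mulmxA [u^T *m _]mulmxA uTu mul1mx.
have sU : U^T = U by rewrite trmx_mul trmxK.
have UA : U *m A = mu *: U.
  by rewrite -mulmxA -[A]sA -trmx_mul Au linearZ /= -scalemxAr.
pose A' := A - mu *: U.
have sA' : A'^T = A' by rewrite linearB linearZ /= sA sU.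
have A'u : A' *m u = 0 by rewrite mulmxBl -scalemxAl Uv uu scale1r Au subrr.
have A'E : A' = (1%:M - U) *m A by rewrite mulmxBl mul1mx UA.
(* the form A' at v is the form A at the part w of v orthogonal to u *)
have pA' : psd A'.
  apply/psdP; split=> // v.
  pose w := v - dotp u v *: u.
  suff -> : dotp v (A' *m v) = dotp w (A *m w) by [].
  have vE : v = w + dotp u v *: u by rewrite subrK.
  have A'w : A' *m v = A' *m w.
    by rewrite {1}vE mulmxDr -scalemxAr A'u scaler0 addr0.
  have wu : dotp u w = 0 by rewrite dotpBr dotpZr uu mulr1 subrr.
  rewrite A'w dotp_sym // A'w -dotp_sym //.
  by rewrite mulmxBl -scalemxAl Uv wu scale0r scaler0 subr0.
(* a zero mu makes the form vanish, hence A, by Cauchy-Schwarz *)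
have mu_neq0 : mu != 0.
  apply: contraNneq A0 => mu00; apply/eqP/matrixP => i j.
  have h v w : dotp v (A *m w) = 0.
    apply/eqP; rewrite -sqrf_eq0 eq_le sqr_ge0 andbT.
    rewrite (le_trans (psd_cauchy_schwarz v w pA)) //.
    rewrite mulr_le0_ge0 //.
    by rewrite (le_trans (hmu _)) // mu00 mul0r.
  have := h (delta_mx i 0) (delta_mx j 0).
  by rewrite -colE /dotp trmx_delta -rowE !mxE.
(* A' = (1 - U) A has its row space in that of A, and kills u, unlike A *)
have rA' : (\rank A' <= r)%N.
  rewrite -ltnS (leq_trans _ rA) // ltnNge; apply/negP => rk.
  have sub : (A' <= A)%MS by rewrite A'E submxMl.
  have : (A <= A')%MS by rewrite -(geq_leqif (mxrank_leqif_sup sub)).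
  move/submxP => [D AD]; move: Au; rewrite AD -mulmxA A'u mulmx0.
  move/esym/eqP; rewrite scaler_eq0 (negbTE mu_neq0) /= -dotp_eq0 uu.
  by rewrite oner_eq0.
have [S [pS SS]] := IHr A' rA' pA'; have [sS qS] := iffLR (psdP _) pS.
have Su : S *m u = 0.
  apply/eqP; rewrite -dotp_eq0; apply/eqP.
  by rewrite -dotp_sym // mulmxA SS A'u dotp0r.
have SU : S *m U = 0 by rewrite mulmxA Su mul0mx.
have US : U *m S = 0 by rewrite -[U]sU -[S]sS -trmx_mul SU trmx0.
exists (S + Num.sqrt mu *: U); split.
  apply/psdP; split; first by rewrite linearD linearZ /= sS sU.
  move=> v; rewrite mulmxDl -scalemxAl dotpDr dotpZr addr_ge0 //.
  rewrite mulr_ge0 ?sqrtr_ge0 // Uv dotpZr [dotp v u]dotpC -expr2.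
  exact: sqr_ge0.
rewrite mulmxDl !mulmxDr -!scalemxAl -!scalemxAr SU US UU !scaler0.
by rewrite addr0 add0r scalerA -expr2 sqr_sqrtr // SS subrK.
Qed.

Lemma psd_rootP n (A : 'M[R]_n) : psd A ->
  psd (psd_root 2 A) /\ psd_root 2 A *m psd_root 2 A = A.
Proof.
move=> /psd_sqrt_exists[S [pS SS]].
have [|pR RR] := @xgetPex _ 0 [set S : 'M[R]_n | psd S /\ S ^+ 2 = A].
  by exists S; split; rewrite // expr2.
by split; rewrite // -[RHS]RR expr2.
Qed.

End Spectrum.

(** * One step of the Riccati recursion *)

Section Update.
Context {R : realType}.

Lemma pos_unit n (A : 'M[R]_n) : A^T = A ->
  (forall v, v != 0 -> 0 < dotp v (A *m v)) -> A \in unitmx.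
Proof.
move=> sA pA; have [//|nuA] := boolP (A \in unitmx).
have [u /pA + Au] := singular_kernel sA nuA.
by rewrite Au dotp0r ltxx.
Qed.

Lemma psd_invmx n (A : 'M[R]_n) : psd A -> psd (invmx A).
Proof.
move=> pA; have [uA|nuA] := boolP (A \in unitmx); last by rewrite invmx_out.
have [sA qA] := iffLR (psdP _) pA.
apply/psdP; split=> [|v]; first by rewrite trmx_inv sA.
by have := qA (invmx A *m v); rewrite mulKVmx // dotpC.
Qed.

(** Expand the nonnegative value of the form [K] at [u - c^-1 K u], where
    [u = K^-1 z]. *)
Lemma invmx_lower_bound n (K : 'M[R]_n) c z : psd K -> K \in unitmx -> 0 < c ->
  (forall u, dotp u (K *m u) <= c * dotp u u) ->
  c^-1 * dotp z z <= dotp z (invmx K *m z).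
Proof.
move=> pK uK c0 hK; have [sK qK] := iffLR (psdP _) pK.
set u := invmx K *m z; have zE : z = K *m u by rewrite mulKVmx.
have := qK (u - c^-1 *: z); rewrite mulmxBr -scalemxAr -zE.
rewrite dotpBr !dotpBl !dotpZr !dotpZl.
rewrite [dotp u (K *m z)]dotp_sym // -zE [dotp u z]dotpC => h.
have h2 : c^-1 * dotp z (K *m z) <= dotp z z by rewrite ler_pdivrMl.
have c'0 : 0 < c^-1 by rewrite invr_gt0.
nra.
Qed.

(** The update [(I + P Omega)^-1 P] equals [X (I + X^T Omega X)^-1 X^T], so that
    the bound on [X^T Omega X] controls how much it shrinks [P]. *)
Lemma update_lower_bound n (X Om : 'M[R]_n) a v : psd Om -> 0 <= a ->
  (forall u, dotp u (X^T *m Om *m X *m u) <= a * dotp u u) ->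
  (1 + a)^-1 * dotp v (X *m X^T *m v)
    <= dotp v (invmx (1%:M + X *m X^T *m Om) *m (X *m X^T) *m v).
Proof.
move=> pOm a0 hG; pose G := X^T *m Om *m X.
have [sG qG] := iffLR (psdP _) (psd_cong X pOm).
pose K : 'M[R]_n := 1%:M + G; pose L : 'M[R]_n := 1%:M + X *m X^T *m Om.
have qK u : dotp u (K *m u) = dotp u u + dotp u (G *m u).
  by rewrite mulmxDl mul1mx dotpDr.
have sK : K^T = K by rewrite linearD /= trmx1 sG.
have pK : psd K.
  by apply/psdP; split=> // u; rewrite qK addr_ge0 ?dotp_ge0 ?qG.
have uK : K \in unitmx.
  by apply: pos_unit => // u u0; rewrite qK ltr_pwDl ?dotp_gt0 ?qG.
have LX : L *m X = X *m K.
  by rewrite /L /K /G mulmxDl mulmxDr mul1mx mulmx1 !mulmxA.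
(* Woodbury's formula for the inverse of L *)
have uL : L \in unitmx.
  suff /mulmx1_unit[] : L *m (1%:M - X *m invmx K *m X^T *m Om) = 1%:M by [].
  rewrite mulmxBr mulmx1 !mulmxA LX -!mulmxA mulKVmx //.
  by rewrite mulmxA addrK.
have invLX : invmx L *m X = X *m invmx K.
  rewrite -[LHS]mulmx1 -(mulmxV uK) !mulmxA -[invmx L *m X *m K]mulmxA.
  by rewrite -LX mulKmx.
have tX w : dotp v (X *m w) = dotp (X^T *m v) w by rewrite dotp_mull trmxK.
rewrite -/L [invmx L *m _]mulmxA invLX -!mulmxA !tX.
apply: invmx_lower_bound => // [|u]; first by rewrite ltr_pwDl ?ltr01.
by rewrite qK mulrDl mul1r lerD2l hG.
Qed.

Lemma precision_bound n d (Rk : 'M[R]_d) (H : 'M[R]_(d, n)) (X : 'M[R]_n) u :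
  psd Rk ->
  dotp u (X^T *m (H^T *m invmx Rk *m H) *m X *m u)
    <= sigma1 (psd_root 2 (invmx Rk) *m H *m X) ^+ 2 * dotp u u.
Proof.
move=> /psd_invmx/psd_rootP[/psdP[sS _] SS].
apply: le_trans (sigma1_bound _ u).
by rewrite dotp_mull -{1}SS !trmx_mul sS !mulmxA.
Qed.

End Update.

(** * Covariance transported over several steps *)

Section Propagation.
Context {R : realType} {n : nat} (M : int -> 'M[R]_n).

Lemma propagator_fwd (k : int) m :
  propagator M (k + m%:Z) k = fwd_propagator M k m.
Proof. by rewrite /propagator lerDl /= addrAC subrr add0r. Qed.

Lemma fwd_propagator_cat (k : int) a b :
  fwd_propagator M k (a + b)
    = fwd_propagator M (k + b%:Z) a *m fwd_propagator M k b.
Proof.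
elim: a => [|a IHa]; first by rewrite mul1mx.
by rewrite addSn /= IHa mulmxA -addrA -PoszD addnS addnC.
Qed.

Lemma fwd_propagator_unit (k : int) m :
  (forall j, M j \in unitmx) -> fwd_propagator M k m \in unitmx.
Proof.
by move=> uM; elim: m => [|m IHm] /=; rewrite ?unitmx1 // unitmx_mul uM.
Qed.

Variable Qc : int -> 'M[R]_n.

(** The quadratic form of [Upsilon_{k:k-m+1}]; counting the [m] terms, and not
    the lag, allows the empty window, at which inductions start. *)
Definition noise_energy (k : int) m v : R :=
  \sum_(i < m) dotp ((propagator M k (k - i%:Z))^T *m v)
    (Qc (k - i%:Z) *m ((propagator M k (k - i%:Z))^T *m v)).

Lemma controllabilityE (k : int) m v :
  dotp v (controllability M Qc k m *m v) = noise_energy k m.+1 v.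
Proof.
rewrite mulmx_suml /dotp mulmx_sumr summxE; apply: eq_bigr => i _.
by rewrite -/(dotp _ _) -!mulmxA -{1}[propagator M k _]trmxK -dotp_mull.
Qed.

Lemma noise_energyS (k : int) m v :
  noise_energy (k + 1) m.+1 v =
    dotp v (Qc (k + 1) *m v) + noise_energy k m ((M (k + 1))^T *m v).
Proof.
have propE (l : int) i :
    propagator M l (l - i%:Z) = fwd_propagator M (l - i%:Z) i.
  by rewrite -[in LHS](subrK i%:Z l) addrK propagator_fwd.
rewrite /noise_energy big_ord_recl /= !propE /= subr0 trmx1 mul1mx.
congr (_ + _); apply: eq_bigr => i _; rewrite !propE /bump /= add1n.
have -> : k + 1 - i.+1%:Z = k - i%:Z.
  by rewrite -addn1 PoszD opprD addrACA subrr addr0.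
have idxE : k - i%:Z + i.+1%:Z = k + 1 by rewrite -addn1 PoszD addrA subrK.
by rewrite /= add0n idxE trmx_mul -!mulmxA.
Qed.

Variables (beta : R) (P : nat -> 'M[R]_n).
Hypotheses (beta_gt0 : 0 < beta) (beta_le1 : beta <= 1).
Hypothesis Q_ge0 : forall k v, 0 <= dotp v (Qc k *m v).
Hypothesis P_step : forall (k : nat) v,
  beta * dotp ((M k.+1%:Z)^T *m v) (P k *m ((M k.+1%:Z)^T *m v))
    + dotp v (Qc k.+1%:Z *m v) <= dotp v (P k.+1 *m v).

(** For simplicity every noise term is discounted by the full [beta ^+ m],
    although the one injected [i] steps before the end only loses
    [beta ^+ i]. *)
Lemma covariance_unroll k m v :
  beta ^+ m * (dotp ((fwd_propagator M k%:Z m)^T *m v)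
                 (P k *m ((fwd_propagator M k%:Z m)^T *m v))
               + noise_energy (k + m)%N%:Z m v)
    <= dotp v (P (k + m)%N *m v).
Proof.
elim: m v => [|m IHm] v.
  by rewrite /noise_energy big_ord0 addr0 trmx1 !mul1mx expr0 mul1r addn0.
rewrite addnS; apply: le_trans (P_step _ _).
have e1 : (k + m).+1%:Z = (k + m)%N%:Z + 1 by rewrite -addn1 PoszD.
have e2 : k%:Z + m.+1%:Z = (k + m).+1%:Z by rewrite -PoszD addnS.
rewrite e1 noise_energyS /= e2 e1 trmx_mul -!mulmxA.
set u := (M _)^T *m v.
rewrite addrCA addrC mulrDr exprS -mulrA; apply: lerD.
  by rewrite ler_pM2l // IHm.
by rewrite ler_piMl ?Q_ge0 // -exprS exprn_ile1 // ltW.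
Qed.

End Propagation.

(** * Contraction over a controllability window *)

Section Contraction.
Context {R : realType} {n : nat} (M Qc : int -> 'M[R]_n).
Variables (beta a pmax : R) (P : nat -> 'M[R]_n) (N : nat).
Hypotheses (beta_gt0 : 0 < beta) (beta_le1 : beta <= 1).
Hypothesis Q_ge0 : forall k v, 0 <= dotp v (Qc k *m v).
Hypothesis P_ge0 : forall k v, 0 <= dotp v (P k *m v).
Hypothesis P_step : forall (k : nat) v,
  beta * dotp ((M k.+1%:Z)^T *m v) (P k *m ((M k.+1%:Z)^T *m v))
    + dotp v (Qc k.+1%:Z *m v) <= dotp v (P k.+1 *m v).
Hypotheses (a_gt0 : 0 < a) (pmax_gt0 : 0 < pmax).
Hypothesis ctrl : forall k : int, N%:Z < k ->
  loewner_le a%:M (controllability M Qc k N).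
Hypothesis P_le : forall k, loewner_le (P k) pmax%:M.

Let c := beta ^+ N.+1 * a.

Let c_gt0 : 0 < c.
Proof. by rewrite mulr_gt0 ?exprn_gt0. Qed.

(** The noise injected during the window passes through at most [N + 1] updates,
    so at least [beta ^+ N.+1] times the controllability Gramian survives. *)
Lemma covariance_window k v :
  beta ^+ N.+1 * dotp ((fwd_propagator M k%:Z N.+1)^T *m v)
      (P k *m ((fwd_propagator M k%:Z N.+1)^T *m v)) + c * dotp v v
    <= dotp v (P (k + N.+1)%N *m v).
Proof.
apply: le_trans (covariance_unroll beta_gt0 beta_le1 Q_ge0 P_step _ _ _).
rewrite mulrDr lerD2l -mulrA ler_pM2l ?exprn_gt0 // -controllabilityE.
have /loewner_leP-/(_ v) :
    loewner_le a%:M (controllability M Qc (k + N.+1)%N N).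
  by apply: ctrl; rewrite ltz_nat addnS ltnS leq_addl.
by rewrite mul_scalar_mx dotpZr.
Qed.

Lemma covariance_coercive k v : c * dotp v v <= dotp v (P (k + N.+1)%N *m v).
Proof.
apply: le_trans (covariance_window k v).
by rewrite lerDr mulr_ge0 ?exprn_ge0 ?P_ge0 // ltW.
Qed.

(** The noise injected over a window is at least [c I >= (c / pmax) P], a fixed
    fraction of the covariance at its end; only the remaining fraction [rho < 1]
    is left to dominate the propagated covariance. *)
Lemma covariance_contraction : exists2 rho, 0 < rho < 1 & forall k v,
  beta ^+ N.+1 * dotp ((fwd_propagator M k%:Z N.+1)^T *m v)
      (P k *m ((fwd_propagator M k%:Z N.+1)^T *m v))
    <= rho * dotp v (P (k + N.+1)%N *m v).
Proof.
have cp : 0 < c / pmax by rewrite divr_gt0 ?c_gt0.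
exists (Num.max (1 - c / pmax) 2^-1) => [|k v].
  by rewrite lt_max gt_max gtrBl cp invr_gt0 ltr0n orbT invf_lt1 ?ltr1n ?ltr0n.
set q := dotp v (P _ *m v).
have q0 : 0 <= q by exact: P_ge0.
apply: (@le_trans _ _ ((1 - c / pmax) * q)); last first.
  by rewrite ler_wpM2r // le_max lexx.
have := covariance_window k v; rewrite -/q => h.
have : q <= pmax * dotp v v.
  by have := loewner_leP v (P_le (k + N.+1)%N); rewrite mul_scalar_mx dotpZr.
rewrite -ler_pdivrMl // => /(ler_wpM2l (ltW c_gt0)).
by rewrite mulrA mulrBl mul1r lerBrDr => /(lerD (lexx _))/le_trans; apply.
Qed.

(** The start is at time [N.+1] because [P 0] may be singular, whereas
    [P N.+1 >= c I]. *)
Lemma propagated_decay : exists rho C, [/\ 0 < rho < 1, 0 < C & forall j v,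
  let u := (fwd_propagator M N.+1%:Z (j * N.+1)%N)^T *m v in
  beta ^+ (j * N.+1) * dotp u u <= C * rho ^+ j * dotp v v].
Proof.
have [rho rho01 step] := covariance_contraction.
have /andP[rho0 _] := rho01.
have iter j v : let u := (fwd_propagator M N.+1%:Z (j * N.+1)%N)^T *m v in
    beta ^+ (j * N.+1) * dotp u (P N.+1 *m u)
      <= rho ^+ j * dotp v (P (N.+1 + j * N.+1)%N *m v).
  elim: j v => [|j IHj] v; cbv zeta.
    by rewrite mul0n addn0 !expr0 !mul1r trmx1 !mul1mx.
  have e : (N.+1 + (N.+1 + j * N.+1) = N.+1 + j * N.+1 + N.+1)%N.
    by rewrite addnC.
  rewrite mulSn e (fwd_propagator_cat _ _ N.+1) trmx_mul -mulmxA.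
  rewrite -PoszD (exprD _ N.+1) -mulrA [rho ^+ _]exprSr -mulrA.
  set w := (fwd_propagator M _ N.+1)^T *m v.
  apply: le_trans (ler_wpM2l (exprn_ge0 _ (ltW rho0)) (step _ v)).
  by rewrite [leRHS]mulrCA ler_pM2l ?exprn_gt0 //.
exists rho, (pmax / c); split=> [//||j v]; first by rewrite divr_gt0 // c_gt0.
cbv zeta; set u := (fwd_propagator M _ _)^T *m v.
rewrite [pmax / c]mulrC -!mulrA -ler_pdivrMl ?invr_gt0 ?c_gt0 // invrK.
rewrite mulrCA.
apply: (@le_trans _ _ (beta ^+ (j * N.+1) * dotp u (P N.+1 *m u))).
  by rewrite ler_wpM2l ?exprn_ge0 ?(ltW beta_gt0) // (covariance_coercive 0).
apply: (le_trans (iter j v)).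
rewrite mulrCA ler_wpM2l ?exprn_ge0 ?(ltW rho0) //.
have := loewner_leP v (P_le (N.+1 + j * N.+1)%N).
by rewrite mul_scalar_mx dotpZr.
Qed.

End Contraction.

(** * Growth along backward Lyapunov vectors *)

Section Growth.
Context {R : realType} {n p : nat}.
Variables (M : int -> 'M[R]_n) (lam : 'I_p.+1 -> R) (kap : 'I_p.+1 -> nat).
Variable B : int -> forall i : 'I_p.+1, 'M[R]_(n, kap i).

Lemma backward_vector_unit k i (j : 'I_(kap i)) :
  (\mxrow_i B k i)^T *m (\mxrow_i B k i) = 1%:M ->
  dotp (col j (B k i)) (col j (B k i)) = 1.
Proof.
move=> /matrixP/(_ (tagnat.Rank i j) (tagnat.Rank i j)); rewrite [RHS]mxE eqxx.
have -> : col j (B k i) = col (tagnat.Rank i j) (\mxrow_i B k i).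
  rewrite -[in LHS](mxrowK (B k) i).
  by apply/matrixP => r s; rewrite mxE [LHS]mxE [RHS]mxE.
move=> h; apply: etrans h; rewrite dotpE [RHS]mxE; apply: eq_bigr => r _.
by rewrite !mxE.
Qed.

(** The convergence hypothesis bounds a logarithm, which is informative only for
    a nonzero norm; this holds since the propagators are invertible. *)
Lemma backward_growth i eps : (forall k, M k \in unitmx) ->
  (forall k, (\mxrow_i B k i)^T *m (\mxrow_i B k i) = 1%:M) ->
  uniform_convergence M lam B -> 0 < eps ->
  exists N : nat, forall (l : int) (m : nat) (j : 'I_(kap i)), (N < m)%N ->
    let u := (fwd_propagator M l m)^T *m col j (B (l + m%:Z) i) in
    expR (2 * (lam i - eps) * m%:R) <= dotp u u.
Proof.
move=> uM oB conv eps0; have [N hN] := conv eps i eps0.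
exists N => l m j Nm; cbv zeta; set u := (fwd_propagator M l m)^T *m _.
have m0 : 0 < m%:R :> R by rewrite ltr0n (leq_trans _ Nm).
have := hN (l + m%:Z) l j; rewrite [l + _ - l]addrAC subrr add0r ltz_nat.
rewrite propagator_fwd => /(_ Nm)/andP[+ _]; rewrite -/u.
have u0 : 0 < norm2 u.
  have [//|] := boolP (0 < norm2 u); rewrite -leNgt => u_le0.
  have : norm2 u = 0 by apply/eqP; rewrite eq_le u_le0 sqrtr_ge0.
  move=> /(congr1 (fun x => x ^+ 2)); rewrite norm2E expr0n /= => /eqP.
  rewrite dotp_eq0 => /eqP uE.
  have := backward_vector_unit j (oB (l + m%:Z)).
  have -> : col j (B (l + m%:Z) i) = 0.
    have uF : (fwd_propagator M l m)^T \in unitmx.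
      by rewrite unitmx_tr fwd_propagator_unit.
    by rewrite -[LHS](mulKmx uF) -/u uE mulmx0.
  by rewrite dotp0r => /eqP; rewrite eq_sym oner_eq0.
rewrite ltrBrDr => h.
have {}h : (lam i - eps) * m%:R < ln (norm2 u).
  by rewrite mulrC -ltr_pdivlMl //; move: h; rewrite addrC.
rewrite -norm2E -[norm2 u]lnK ?posrE // -expRM_natl ler_expR.
by rewrite -mulrA ler_pM2l ?ltr0n // ltW.
Qed.

End Growth.

(** * Growth against contraction *)

(** The factor lost per window in [propagated_decay] beats the slack [eps] left
    by the growth rate, once [eps] is small compared with [- ln rho]. *)
Lemma growth_beats_decay (R : realType) (beta l rho C : R) (m : nat) :
  0 < beta -> 0 < rho < 1 -> 0 < C -> (0 < m)%N ->
  (forall eps, 0 < eps -> exists N : nat, forall j : nat, (N < j * m)%N ->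
     beta ^+ (j * m) * expR (2 * (l - eps) * (j * m)%:R) <= C * rho ^+ j) ->
  beta * expR (2 * l) < 1.
Proof.
move=> beta0 /andP[rho0 rho1] C0 m0 decay; rewrite ltNge; apply/negP => le1.
have mR : 0 < m%:R :> R by rewrite ltr0n.
have lnr : 0 < - ln rho by rewrite oppr_gt0 ln_lt0 // rho0.
(* with this eps the slack over a window of length m is theta = sqrt rho *)
pose eps := - ln rho / (4 * m%:R).
have eps0 : 0 < eps by rewrite divr_gt0 // mulr_gt0 ?ltr0n.
have [N hN] := decay eps eps0.
pose theta := expR (- (2 * eps * m%:R)).
have theta0 : 0 < theta by exact: expR_gt0.
have theta2 : theta ^+ 2 = rho.
  rewrite -expRM_natl -[RHS]lnK ?posrE //; congr expR.
  by rewrite /eps; field; rewrite gt_eqF.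
have theta1 : theta < 1.
  by rewrite -(@ltr_pXn2r _ 2) ?nnegrE ?(ltW theta0) // theta2 expr1n.
have low j : (N < j * m)%N -> 1 <= C * theta ^+ j.
  move=> /hN h; rewrite -(ler_pM2r (exprn_gt0 j theta0)) mul1r -mulrA -exprD.
  rewrite addnn -mul2n exprM theta2 (le_trans _ h) //.
  have -> : expR (2 * (l - eps) * (j * m)%:R)
          = expR (2 * l) ^+ (j * m) * theta ^+ j.
    rewrite -!expRM_natl -expRD; congr expR; rewrite natrM; ring.
  by rewrite mulrA -exprMn ler_peMl ?exprn_ge0 ?(ltW theta0) // exprn_ege1.
have : theta ^+ j @[j --> \oo] --> (0 : R).
  by apply: cvg_expr; rewrite ger0_norm ?(ltW theta0).
move=> /cvgrPdist_lt/(_ C^-1); rewrite invr_gt0 => /(_ C0)[K _ hK].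
have := hK (K + N.+1)%N (leq_addr _ _); rewrite sub0r normrN.
rewrite ger0_norm ?exprn_ge0 ?(ltW theta0) // -[C^-1]mulr1.
rewrite ltr_pdivlMl // ltNge low //.
by rewrite (@leq_trans (K + N.+1)) ?leq_pmulr // addnS ltnS leq_addl.
Qed.

(** Any bound [alpha] on the gains will do in place of their supremum, and any
    exponent in place of the largest one. *)
Lemma gain_gt_growth (R : realType) (n d p : nat)
  (M : int -> 'M[R]_n) (H : int -> 'M[R]_(d, n))
  (Qc : int -> 'M[R]_n) (Rc : int -> 'M[R]_d) (P X : nat -> 'M[R]_n)
  (lam : 'I_p.+1 -> R) (kap : 'I_p.+1 -> nat)
  (B : int -> forall i : 'I_p.+1, 'M[R]_(n, kap i)) (alpha : R) i :
  (forall k, M k \in unitmx) -> bounded_covariances Qc Rc ->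
  (forall k, (\mxrow_i B k i)^T *m (\mxrow_i B k i) = 1%:M) ->
  uniform_convergence M lam B -> (0 < kap i)%N ->
  riccati M H Qc Rc P -> (forall k, P k = X k *m (X k)^T) ->
  uniformly_completely_controllable M Qc ->
  (exists p_sup : R, 0 < p_sup /\ forall k, loewner_le (P k) p_sup%:M) ->
  (forall k : nat,
     sigma1 (psd_root 2 (invmx (Rc k%:Z)) *m H k%:Z *m X k) ^+ 2 <= alpha) ->
  expR (2 * lam i) < 1 + alpha.
Proof.
move=> uM [q_inf [q_sup [r_inf [r_sup [q0 r0 Qb Rb]]]]] oB conv kap0 [_ ric].
move=> PX [N [a [b [_ a0 _ ctrl]]]] [pmax [pmax0 P_le]] hsup.
have alpha0 : 0 <= alpha := le_trans (sqr_ge0 _) (hsup 0%N).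
have alpha1 : 0 < 1 + alpha by rewrite ltr_pwDl.
have Q_ge0 k v : 0 <= dotp v (Qc k *m v).
  have [/loewner_leP-/(_ v) h _] := Qb k; apply: le_trans h.
  by rewrite mul_scalar_mx dotpZr mulr_ge0 ?dotp_ge0.
have pR k : psd (Rc k).
  have [rR _] := Rb k; have [sR _] := iffLR (psdP _) rR.
  apply/psdP; split=> [|v].
    by rewrite -(subrK r_inf%:M (Rc k)) linearD /= sR tr_scalar_mx.
  apply: le_trans (loewner_leP v rR).
  by rewrite mul_scalar_mx dotpZr mulr_ge0 ?dotp_ge0 ?ltW.
have P_ge0 k v : 0 <= dotp v (P k *m v).
  by rewrite PX -{1}[X k]trmxK; case/psdP: (psd_gram (X k)^T).
pose beta := (1 + alpha)^-1.
have beta0 : 0 < beta by rewrite invr_gt0.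
have beta1 : beta <= 1 by rewrite invf_le1 // lerDl.
have P_step (k : nat) v :
    beta * dotp ((M k.+1%:Z)^T *m v) (P k *m ((M k.+1%:Z)^T *m v))
      + dotp v (Qc k.+1%:Z *m v) <= dotp v (P k.+1 *m v).
  rewrite ric mulmxDl dotpDr lerD2r -!mulmxA -[in leRHS](trmxK (M k.+1%:Z)).
  rewrite -dotp_mull trmxK; set u := (M _)^T *m v.
  rewrite mulmxA PX; apply: update_lower_bound => // [|w].
    by apply: psd_cong; exact: psd_invmx.
  apply: le_trans (precision_bound _ _ _ (pR _)) _.
  by rewrite ler_wpM2r ?dotp_ge0.
have ctrl_lower k : N%:Z < k -> loewner_le a%:M (controllability M Qc k N).
  by move=> /ctrl[].
have [rho [C [rho01 C0 decay]]] := propagated_decay beta0 beta1 Q_ge0 P_ge0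
  P_step a0 pmax0 ctrl_lower P_le.
have beta_growth : beta * expR (2 * lam i) < 1.
  apply: (growth_beats_decay beta0 rho01 C0 (ltn0Sn N)) => eps eps0.
  have [N' hN'] := backward_growth i uM oB conv eps0.
  exists N' => j /(hN' N.+1%:Z _ (Ordinal kap0)) /=.
  set bv := col _ _ => low.
  have := decay j bv.
  rewrite backward_vector_unit // mulr1; apply: le_trans.
  by rewrite ler_wpM2l // exprn_ge0 // ltW.
by move: beta_growth; rewrite mulrC ltr_pdivrMr // mul1r.
Qed.

Theorem corollary2
  (R : realType) (n d p : nat) (dn : (d <= n)%N)
  (M : int -> 'M[R]_n) (H : int -> 'M[R]_(d, n))
  (Qc : int -> 'M[R]_n) (Rc : int -> 'M[R]_d)
  (disp : measure_display) (T : measurableType disp) (Pr : probability T R)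
  (x w : int -> T -> 'cV[R]_n) (y v : int -> T -> 'cV[R]_d)
  (P X : nat -> 'M[R]_n)
  (lam : 'I_p.+1 -> R) (kap : 'I_p.+1 -> nat)
  (E : int -> 'I_p.+1 -> {vspace 'cV[R]_n})
  (W : int -> 'M[R]_n)
  (B : int -> forall i : 'I_p.+1, 'M[R]_(n, kap i))
  (M_unit : forall k, M k \in unitmx)
  (cov_bounds : bounded_covariances Qc Rc)
  (noise : gaussian_white_noises Pr w v Qc Rc)
  (model : state_space_model M H x y w v)
  (regular : lyapunov_perron_regular M lam kap E)
  (far_past : far_past_operator M lam kap W)
  (backward : backward_lyapunov_vectors M lam W B)
  (unif_conv : uniform_convergence M lam B)
  (P_riccati : riccati M H Qc Rc P)
  (P_root : forall k, P k = X k *m (X k)^T)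
  (controllable : uniformly_completely_controllable M Qc)
  (P_bounded : exists p_sup : R,
     0 < p_sup /\ forall k, loewner_le (P k) p_sup%:M) :
  ((expR (2 * lam ord0))%:E /
     (1 + ereal_sup [set ((sigma1 (psd_root 2 (invmx (Rc k%:Z))
                                     *m H k%:Z *m X k)) ^+ 2)%:E
                    | k in [set: nat]])
   < 1)%E.
Proof.
have [_ kap_pos _ _ _] := regular.
have [oB _ _ _] := backward.
set S := [set _ | _ in _].
have S_le (k : nat) : ((sigma1 (psd_root 2 (invmx (Rc k%:Z))
    *m H k%:Z *m X k) ^+ 2)%:E <= ereal_sup S)%E.
  by apply: ereal_sup_ubound; exists k.
have S_ge0 : (0 <= ereal_sup S)%E.
  by apply: le_trans (S_le 0%N); rewrite lee_fin sqr_ge0.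
case: (ereal_sup S) S_le S_ge0 => [alpha||] S_le S_ge0 //; last first.
  by rewrite addey // invey mule0 lte_fin ltr01.
have alpha0 : 0 < 1 + alpha by rewrite ltr_pwDl.
rewrite -EFinD inver gt_eqF // lte_pdivrMr // mul1e lte_fin.
apply: (gain_gt_growth M_unit cov_bounds oB unif_conv _ P_riccati P_root
  controllable P_bounded) => [|k]; first by have [] := kap_pos 0 ord0.
by have := S_le k; rewrite lee_fin.
Qed.
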